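(* Let $G=G_1*_{G_0} G_2$ be an amalgamated free product of two finitely generated virtually abelian groups $G_1,G_2$ over a common virtually cyclic subgroup $G_0$. Then there exist a finitely generated virtually abelian group $E$ and a homomorphism $\nu: G \to E$ such that the restriction of $\nu$ to $G_i$ is injective, for $i=1,2$.
   Context: A group is virtually abelian (virtually cyclic) if it has a finite index subgroup that is abelian (respectively, cyclic); finite groups are virtually cyclic. In an amalgamated free product $G_1*_{G_0}G_2$ the group $G_0$ is regarded as a subgroup of both $G_1$ and $G_2$, and $G_1,G_2$ are regarded as subgroups of $G_1*_{G_0}G_2$. *)

(* Defs.v *)
From mathcomp Require Import all_boot.
From mathcomp Require Import boolp classical_sets functions cardinality.

Set Implicit Arguments.
Unset Strict Implicit.
Unset Printing Implicit Defensive.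

Local Open Scope classical_set_scope.
Local Open Scope group_scope.

Section GroupProperties.
Variable G : groupType.
Implicit Types H S : set G.

Definition subgroup H : Prop := group_closed (mem H).

Definition generated S : set G := smallest subgroup S.

Definition left_coset H (x : G) : set G := [set x * h | h in H].

Definition finite_index H : Prop := finite_set (range (left_coset H)).

Definition abelian_subset H : Prop := {in H &, commutative (@mul G)}.

Definition cyclic_subset H : Prop := exists x : G, H = generated [set x].

Definition finitely_generated : Prop :=
  exists S, finite_set S /\ generated S = [set: G].

Definition virtually_abelian : Prop :=
  exists H, [/\ subgroup H, finite_index H & abelian_subset H].

Definition virtually_cyclic : Prop :=
  exists H, [/\ subgroup H, finite_index H & cyclic_subset H].

End GroupProperties.

Arguments finitely_generated : clear implicits.
Arguments virtually_abelian : clear implicits.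
Arguments virtually_cyclic : clear implicits.

Notation group_hom G H := (UMagmaMorphism.type G H).

(* [G], with the maps [i1] and [i2], is the amalgamated free product of [G1] and
   [G2] over [G0], where [G0] is a common subgroup through the injections [j1]
   and [j2]: a pushout of [j1] and [j2] in the category of groups. *)
Definition amalgamated_free_product (G0 G1 G2 G : groupType)
    (j1 : group_hom G0 G1) (j2 : group_hom G0 G2)
    (i1 : group_hom G1 G) (i2 : group_hom G2 G) : Prop :=
  [/\ injective j1, injective j2, i1 \o j1 =1 i2 \o j2 &
      forall (K : groupType) (f1 : group_hom G1 K) (f2 : group_hom G2 K),
        f1 \o j1 =1 f2 \o j2 ->
        exists2 f : group_hom G K, f \o i1 =1 f1 /\ f \o i2 =1 f2 &
          forall g : group_hom G K, g \o i1 =1 f1 -> g \o i2 =1 f2 -> g =1 f].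

(* Main.v *)
(* Choose torsion-free abelian normal subgroups [A_i] of finite index in [G_i] that
   meet [G_0] in the same cyclic subgroup [<e>]. (If [G_0] is infinite, start from
   any such [A_i] and any [e] of infinite order in both and in [G_0]; writing
   [e = k_i p_i] with [p_i] primitive in [A_i], replace [A_i] by [k_i A_i].)
   For a conjugate [e''] of [e] in [A_2], the map [a |-> a (x) e''] on [A_1] induces
   a homomorphism from [G_1] to a wreath product of [A_1 (x) A_2] with the
   symmetric group of the set of cosets of [A_1]; use one copy of this coset set
   for each conjugate [e'']. Proceed symmetrically with [G_2] and the maps
   [a |-> e' (x) a]. The restrictions to [G_0] of both homomorphisms are governed
   by the same family, that of all [e' (x) e''], so that the index sets can be
   identified in such a way that the homomorphisms agree on [G_0]. When [G_0] is
   finite, it meets [A_i] trivially and [A_1 x A_2] replaces [A_1 (x) A_2].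
   Finally, [E] is the subgroup generated by both images.

   In place of the tensor product, the proof uses the functions
   [(lam, mu) |-> lam a1 * mu a2] on pairs of integer-valued functionals. *)

Require Import Defs.
From HB Require Import structures.
From mathcomp Require Import all_boot all_algebra perm zify ring.
From mathcomp Require Import boolp classical_sets functions cardinality.

Set Implicit Arguments.
Unset Strict Implicit.
Unset Printing Implicit Defensive.

Import GRing.Theory.
Local Open Scope classical_set_scope.
Local Open Scope group_scope.

(** * Subgroups of finite index *)

Lemma expgF_commute (G : groupType) (x : G) m n k :
  (x ^+ m / x ^+ n) ^+ k = x ^+ (m * k) / x ^+ (n * k).
Proof. by rewrite !expgnA expgnFl//; apply: commuteX2. Qed.

Lemma conj_powers (G : groupType) (g x : G) n : g * x ^+ n / g = (g * x / g) ^+ n.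
Proof.
by elim: n => [|n IHn]; rewrite ?expg0 ?mulg1 ?mulgV// !expgS -IHn !mulgA mulgVK.
Qed.

Lemma subgroupE (G : groupType) (H : set G) :
  subgroup H <-> H 1 /\ forall x y, H x -> H y -> H (x / y).
Proof.
by split=> -[H1 HF]; split; rewrite ?inE // in H1 * => x y;
  have := HF x y; rewrite !inE.
Qed.

Section SubgroupTheory.
Variables (G : groupType) (H : set G).
Hypothesis sH : subgroup H.

Lemma subgroup1 : H 1. Proof. by have /subgroupE[] := sH. Qed.

Lemma subgroupF x y : H x -> H y -> H (x / y).
Proof. by have /subgroupE[_] := sH; apply. Qed.

Lemma subgroupV x : H x -> H x^-1.
Proof. by rewrite -div1g; apply/subgroupF/subgroup1. Qed.

Lemma subgroupM x y : H x -> H y -> H (x * y).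
Proof. by move=> Hx Hy; rewrite -[y]invgK; apply/subgroupF/subgroupV. Qed.

Lemma subgroupX x n : H x -> H (x ^+ n).
Proof.
move=> Hx; elim: n => [|n IHn]; rewrite ?expg0 ?expgS; first exact: subgroup1.
exact: subgroupM.
Qed.

End SubgroupTheory.

Lemma generated_subgroup (G : groupType) (S : set G) : subgroup (generated S).
Proof.
apply/subgroupE; split=> [M [/subgroup1]//|x y Sx Sy M SM].
by have [sM _] := SM; apply: subgroupF (Sx M SM) (Sy M SM).
Qed.

Lemma sub_generated (G : groupType) (S : set G) : S `<=` generated S.
Proof. exact: sub_gen_smallest. Qed.

Lemma generated_min (G : groupType) (S H : set G) :
  subgroup H -> S `<=` H -> generated S `<=` H.
Proof. exact: smallest_sub. Qed.

Lemma preimage_subgroup (G K : groupType) (f : group_hom G K) (H : set K) :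
  subgroup H -> subgroup (f @^-1` H).
Proof.
move=> sH; apply/subgroupE; split=> [|x y]; first by rewrite /= gmulf1; apply: subgroup1.
by rewrite /= gmulfF; apply: subgroupF.
Qed.

Lemma image_subgroup (G K : groupType) (f : group_hom G K) (H : set G) :
  subgroup H -> subgroup (f @` H).
Proof.
move=> sH; apply/subgroupE; split.
  by exists 1; rewrite ?gmulf1//; apply: subgroup1.
move=> _ _ [x Hx <-] [y Hy <-].
by exists (x / y); rewrite ?gmulfF//; apply: subgroupF.
Qed.

Lemma fiber_repr (X F : Type) (x0 : X) (f : X -> F) :
  exists r : F -> X, forall x, f (r (f x)) = f x.
Proof.
suff /choice[r rP] : forall k, exists y, forall x, f x = k -> f y = k.
  by exists r => x; apply: rP (erefl).
move=> k; have [[x xk]|nk] := pselect (exists x, f x = k); first by exists x.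
by exists x0 => x xk; case: nk; exists x.
Qed.

(* Finite index, in terms of right cosets: the cosets [H x] can be told apart by
   a function with values in a finite type. *)
Definition finite_cosets (G : groupType) (H : set G) : Prop :=
  exists (F : finType) (f : G -> F), forall x y, f x = f y -> H (x / y).

Lemma finite_index_cosets (G : groupType) (H : set G) :
  subgroup H -> finite_index H -> finite_cosets H.
Proof.
move=> sH [n cardn]; have /card_set_bijP[f [fI finj fsur]] := cardn.
(* Inversion carries the left coset of [x^-1] to the right coset of [x], so the numbering of left
   cosets labels the right cosets. *)
have f_lt x : (f (left_coset H x^-1) < n)%N by apply: fI; exists x^-1.
exists 'I_n, (fun x => Ordinal (f_lt x)) => x y /(congr1 val)/= /finj.
rewrite !inE => /(_ (ex_intro2 _ _ _ I erefl) (ex_intro2 _ _ _ I erefl)) eqxy.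
have : left_coset H x^-1 x^-1 by exists 1; rewrite ?mulg1//; apply: subgroup1.
rewrite eqxy => -[h Hh hE]; rewrite -[x]invgK -hE invgM invgK.
by rewrite mulgK; apply: subgroupV.
Qed.

Lemma cosets_finite_index (G : groupType) (H : set G) :
  subgroup H -> finite_cosets H -> finite_index H.
Proof.
move=> sH [F [f fP]].
have [r rP] := fiber_repr 1 f.
apply: (@sub_finite_set _ _ [set left_coset H (r k)^-1 | k in [set: F]]); last first.
  exact/finite_image/finite_finset.
move=> _ [x _ <-]; exists (f x^-1) => //.
have Hq : H (r (f x^-1) * x).
  by have := fP _ _ (rP x^-1); rewrite invgK.
apply/seteqP; split=> _ [h Hh <-].
  exists ((r (f x^-1) * x)^-1 * h); first by apply: subgroupM => //; apply: subgroupV.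
  by rewrite invgM !mulgA mulgV mul1g.
exists (r (f x^-1) * x * h); first exact: subgroupM.
by rewrite !mulgA mulVg mul1g.
Qed.

Lemma finite_cosets_preimage (G K : groupType) (f : group_hom G K) (H : set K) :
  finite_cosets H -> finite_cosets (f @^-1` H).
Proof.
by move=> [F [k kP]]; exists F, (k \o f) => x y /kP; rewrite /preimage/= gmulfF.
Qed.

Lemma finite_cosets_powers (G : groupType) (H : set G) x :
  subgroup H -> finite_cosets H -> exists2 n, (0 < n)%N & H (x ^+ n).
Proof.
move=> sH [F [f fP]].
(* Pigeonhole: there is one power more than there are labels, so two powers of [x] lie in the same
   coset. *)
have : ~ injective (fun i : 'I_#|F|.+1 => f (x ^+ i)).
  by move=> /leq_card; rewrite card_ord ltnn.
move=> /existsNP[i /existsNP[j /not_implyP[/fP Hij /eqP neij]]].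
wlog ltij : i j Hij neij / (i < j)%N.
  move=> hw; move: (neij); rewrite -val_eqE neq_ltn => /orP[]; first exact: hw.
  by apply: hw; rewrite 1?eq_sym//; rewrite -invgF; apply: subgroupV.
exists (j - i)%N; first by rewrite subn_gt0.
by rewrite expgnFr ?(ltnW ltij)// -invgF; apply: subgroupV.
Qed.

Definition normal_set (G : groupType) (H : set G) :=
  forall g x, H x -> H (g * x / g).

(* The core is the kernel of the action on the right cosets [H r_k]. *)
Lemma normal_core (G : groupType) (H : set G) :
  subgroup H -> finite_cosets H ->
  exists N : set G, [/\ subgroup N, N `<=` H, normal_set N & finite_cosets N].
Proof.
move=> sH [F [f fP]]; exists [set x | forall g, H (g * x / g)]; split.
- apply/subgroupE; split=> [g|x y Nx Ny g].
    by rewrite mulg1 mulgV; apply: subgroup1.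
  by have := subgroupF sH (Nx g) (Ny g); rewrite !invgM !invgK !mulgA mulgVK.
- by move=> x /(_ 1); rewrite mul1g divg1.
- by move=> g x Nx h /=; have := Nx (h * g); rewrite invgM !mulgA.
- have [r rP] := fiber_repr 1 f.
  exists {ffun F -> F}, (fun x => [ffun k => f (r k * x)]) => x y /ffunP eqxy g.
  have := eqxy (f g); rewrite !ffunE => /fP; set q := r _ => Hq.
  have Hgq : H (g / q) by apply: fP; rewrite rP.
  have := subgroupF sH (subgroupM sH Hgq Hq) Hgq.
  by rewrite !invgM !invgK !mulgA !mulgVK.
Qed.

(** Related elements have equal classes as sets, and the element that [xget] picks from a nonempty
    set does not depend on the default value. *)
Lemma equivalence_repr (X : choiceType) (R : X -> X -> Prop) :
  (forall x, R x x) -> (forall x y, R x y -> R y x) ->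
  (forall x y z, R x y -> R y z -> R x z) ->
  exists rep : X -> X,
    (forall x, R x (rep x)) /\ (forall x y, R x y -> rep x = rep y).
Proof.
move=> Rxx Rs Rt; exists (fun x => xget x [set y | R x y]).
have RxP x : R x (xget x [set y | R x y]) by apply: xgetPex; exists x.
split=> // x y Rxy.
have -> : [set z | R x z] = [set z | R y z].
  by apply/seteqP; split=> z /=; apply: Rt => //; apply: Rs.
by rewrite /xget; case: pselect => // -[]; exists y; apply/asboolP/Rxx.
Qed.

Lemma finite_classes (X : choiceType) (R : X -> X -> Prop) (F : finType) (f : X -> F) :
  (forall x, R x x) -> (forall x y, R x y -> R y x) ->
  (forall x y z, R x y -> R y z -> R x z) -> (forall x y, f x = f y -> R x y) ->
  exists (T : finType) (rep : T -> X) (cl : X -> T),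
    (forall x, R x (rep (cl x))) /\ (forall t u, R (rep t) (rep u) -> t = u).
Proof.
move=> Rxx Rs Rt fR; have [rep [repP repE]] := equivalence_repr Rxx Rs Rt.
(* One class may carry several values of [f], so classes are indexed by the values at canonical
   representatives only. *)
pose T := {k : F | `[< exists x, f (rep x) = k >]}.
have clP x : `[< exists y, f (rep y) = f (rep x) >] by apply/asboolP; exists x.
have /choice[g gP] : forall t : T, exists y, f (rep y) = val t.
  by case=> k kP; apply/asboolP.
exists T, (rep \o g), (fun x => exist _ (f (rep x)) (clP x)); split=> [x|t u /= Rtu].
  by apply: Rt (repP x) _; apply: fR; rewrite /= gP.
apply: val_inj; rewrite -!gP; congr (f _); apply: repE.
by apply: Rt (repP _) (Rt _ _ _ Rtu _); apply: Rs (repP _).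
Qed.

Lemma coset_repr (G : groupType) (H : set G) : subgroup H -> finite_cosets H ->
  exists (Q : finType) (r : Q -> G) (cl : G -> Q),
    (forall x, H (x / r (cl x))) /\ (forall k l, H (r k / r l) -> k = l).
Proof.
move=> sH [F [f fP]]; apply: (@finite_classes _ (fun x y => H (x / y)) _ f) fP.
- by move=> x; rewrite mulgV; apply: subgroup1.
- by move=> x y Hxy; rewrite -invgF; apply: subgroupV.
- by move=> x y z Hxy Hyz; have := subgroupM sH Hxy Hyz; rewrite divgKA.
Qed.

(** * Finitely generated abelian groups *)

Section FinitelyGeneratedZmodule.
Local Open Scope ring_scope.
Variable A : zmodType.
Implicit Types (a b x d : A) (s t : seq A).

Lemma subrACA a b (c d : A) : (a - b) - (c - d) = (a - c) - (b - d).
Proof. by rewrite !opprD !opprK addrACA. Qed.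

(** Peeling off one generator at a time lets the facts below be proved by induction on [s], without
    the structure theorem for finitely generated abelian groups. *)
Fixpoint zspan s a : Prop :=
  if s is x :: t then exists n : int, zspan t (a - x *~ n) else a = 0.

Lemma zspan0 s : zspan s 0.
Proof. by elim: s => // x s IHs; exists 0; rewrite mulr0z subr0. Qed.

Lemma zspanB s a b : zspan s a -> zspan s b -> zspan s (a - b).
Proof.
elim: s a b => [a b -> ->|x s IHs a b [n an] [m bm]]; first by rewrite subr0.
by exists (n - m); have := IHs _ _ an bm; rewrite mulrzBr subrACA.
Qed.

Lemma zspanN s a : zspan s a -> zspan s (- a).
Proof. by rewrite -sub0r; apply/zspanB/zspan0. Qed.

Lemma zspanD s a b : zspan s a -> zspan s b -> zspan s (a + b).
Proof. by move=> sa /zspanN sb; rewrite -[b]opprK; apply: zspanB. Qed.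

Lemma zspanMn s a n : zspan s a -> zspan s (a *+ n).
Proof.
by move=> sa; elim: n => [|n IHn]; rewrite ?mulr0n ?mulrS; [apply: zspan0|apply: zspanD].
Qed.

Lemma zspanMz s a n : zspan s a -> zspan s (a *~ n).
Proof. by case: n => n sa; [|apply: zspanN]; apply: zspanMn. Qed.

Definition torsion_free := forall a n, (0 < n)%N -> a *+ n = 0 -> a = 0.

(** If a positive multiple [x *+ k] lies in the span of the other generators, multiplication by [k]
    reduces to that span. Otherwise a torsion element cannot involve [x], and the old exponent still
    works. *)
Lemma torsion_exponent s :
  exists2 M, (0 < M)%N & forall a n, zspan s a -> (0 < n)%N -> a *+ n = 0 -> a *+ M = 0.
Proof.
elim: s => [|x s [M M0 IHs]]; first by exists 1%N => // a n ->; rewrite mul0rn.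
have [[k k0 xk]|nk] := pselect (exists2 k, (0 < k)%N & zspan s (x *+ k)).
  exists (k * M)%N => [|a n [j aj] n0 an]; first by rewrite muln_gt0 k0.
  rewrite mulrnA; apply: (IHs _ n) => //; last by rewrite mulrnAC an mul0rn.
  rewrite -[a](subrK (x *~ j)) mulrnDl; apply: zspanD; first exact: zspanMn.
  by rewrite pmulrn mulrzAC -pmulrn; apply: zspanMz.
exists M => // a n [j aj] n0 an; apply: (IHs a n) => //.
suff j0 : j = 0 by rewrite j0 mulr0z subr0 in aj.
have xnj : zspan s (x *~ (j * n)).
  have := zspanN (zspanMn n aj).
  by rewrite mulrnBl an sub0r opprK pmulrn -mulrzA.
apply: contrapT => /eqP jN0; apply: nk; exists `|(j * n)%R|%N; first lia.
by case: (j * n) xnj => m xm //; rewrite -[_ *+ _]opprK; apply: zspanN.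
Qed.

Lemma zspan_mod s M : (0 < M)%N ->
  exists (F : finType) (f : A -> F), forall a b,
    zspan s a -> zspan s b -> f a = f b -> exists c, a - b = c *+ M.
Proof.
move=> M0; elim: s => [|x s [F [f fP]]].
  by exists unit, (fun=> tt) => a b -> -> _; exists 0; rewrite subr0 mul0rn.
have /choice[j jP] a : exists n, zspan (x :: s) a -> zspan s (a - x *~ n).
  by have [[n an]|] := pselect (zspan (x :: s) a); [exists n|exists 0].
have jlt a : (`|(j a %% M)%Z| < M)%N by lia.
(* The label records the chosen coefficients modulo [M], one generator at a time. *)
exists (F * 'I_M)%type, (fun a => (f (a - x *~ j a), Ordinal (jlt a))).
move=> a b /jP sa /jP sb [/(fP _ _ sa sb)[c cE] jE].
exists (c + x *~ ((j a - j b) %/ M)%Z); rewrite mulrnDl -cE pmulrn -mulrzA divzK.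
  by rewrite mulrzBr subrACA subrK.
have := congr1 Posz jE; rewrite !gez0_abs ?modz_ge0 -?lt0n// => jE'.
by rewrite -eqz_mod_dvd; apply/eqP.
Qed.

(** Starting from the coordinate on the multiples of [d], the functional is extended over one
    generator at a time, and rescaled where needed to keep its values integral. It is additive on
    the span only. *)
Lemma int_functional_span d s : (forall n, (0 < n)%N -> d *+ n != 0) ->
  exists2 lam : A -> int, lam d != 0 & forall a b,
    zspan (s ++ [:: d]) a -> zspan (s ++ [:: d]) b -> lam (a - b) = lam a - lam b.
Proof.
move=> dN0; elim: s => [|x s [lam lamd lamB]] /=.
  have dI n : d *~ n = 0 -> n = 0.
    case: (intP n) => // m; first by move/eqP; rewrite -pmulrn (negPf (dN0 _ _)).
    by rewrite mulrNz => /eqP; rewrite oppr_eq0 -pmulrn (negPf (dN0 _ _)).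
  have /choice[j jP] a : exists n, zspan [:: d] a -> a = d *~ n.
    have [[n /subr0_eq an]|] := pselect (zspan [:: d] a); [by exists n|by exists 0].
  have dd : zspan [:: d] d by exists 1; rewrite mulr1z /= subrr.
  exists j => [|a b da db].
    by apply/eqP => j0; have := dN0 1%N; rewrite mulr1n (jP _ dd) j0 mulr0z eqxx => /(_ isT).
  apply/eqP; rewrite -subr_eq0; apply/eqP/dI.
  rewrite !mulrzBr -(jP _ (@zspanB [:: d] _ _ da db)) -(jP _ da) -(jP _ db).
  exact: subrr.
set t := s ++ [:: d] in lamB *.
have lam0 : lam 0 = 0 by rewrite -(subrr 0) (lamB _ _ (zspan0 t) (zspan0 t)) subrr.
have lamN a : zspan t a -> lam (- a) = - lam a.
  by move=> ta; rewrite -sub0r (lamB _ _ (zspan0 t) ta) lam0 sub0r.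
have lamD a b : zspan t a -> zspan t b -> lam (a + b) = lam a + lam b.
  by move=> ta tb; rewrite -[b]opprK (lamB _ _ ta (zspanN tb)) lamN ?opprK.
have lamMn a n : zspan t a -> lam (a *+ n) = lam a *+ n.
  by move=> ta; elim: n => [|n IHn]; rewrite ?mulr0n ?mulrS// lamD ?IHn//; apply: zspanMn.
have lamMz a n : zspan t a -> lam (a *~ n) = lam a *~ n.
  by case: n => n ta; rewrite /= ?lamN ?lamMn//; apply: zspanMn.
(* The extension will be [k * lam] on the span of [t], with value [v] at [x]. If a nonzero multiple
   [x *~ k] lies in this span, then [v] must be [lam (x *~ k)]; if there is none, [k = 1] and
   [v = 0] will do. *)
have [k [v [k0 vP]]] : exists k v, (k != 0) /\
    forall j, zspan t (x *~ j) -> k * lam (x *~ j) = j * v.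
  have [[k k0 xk]|nk] := pselect (exists2 k, k != 0 & zspan t (x *~ k)).
    exists k, (lam (x *~ k)); split=> // j xj.
    rewrite mulrC -[LHS]mulrzz -[RHS]mulrC -[RHS]mulrzz -!lamMz// -!mulrzA.
    by rewrite mulrC.
  exists 1, 0; split=> // j xj; rewrite mulr0 mul1r.
  have -> : j = 0 by apply: contrapT => /eqP j0; apply: nk; exists j.
  by rewrite mulr0z.
have /choice[j jP] a : exists n, zspan (x :: t) a -> zspan t (a - x *~ n).
  by have [[n an]|] := pselect (zspan (x :: t) a); [exists n|exists 0].
(* The value does not depend on the coefficient of [x] chosen in a decomposition of [a]. *)
have lamE a n : zspan t (a - x *~ n) ->
    k * lam (a - x *~ j a) + j a * v = k * lam (a - x *~ n) + n * v.
  move=> ta; have ta' : zspan t (a - x *~ j a) by apply: jP; exists n.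
  have E : x *~ (n - j a) = (a - x *~ j a) - (a - x *~ n).
    by rewrite mulrzBr subrACA subrr sub0r opprB.
  have := vP (n - j a); rewrite E => /(_ (zspanB ta' ta)); rewrite lamB//.
  lia.
exists (fun a => k * lam (a - x *~ j a) + j a * v).
  have dt : zspan t (d - x *~ 0).
    by rewrite mulr0z subr0 /t; elim: (s) => [|y s' IHs]; [exists 1|exists 0];
      rewrite ?mulr1z ?mulr0z ?subrr ?subr0.
  by rewrite (lamE _ _ dt) mul0r addr0 mulr0z subr0 mulf_neq0.
move=> a b /jP ta /jP tb.
have E : a - b - x *~ (j a - j b) = (a - x *~ j a) - (b - x *~ j b).
  by rewrite mulrzBr subrACA.
rewrite (lamE _ (j a - j b)) E; last exact: zspanB.
by rewrite lamB//; ring.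
Qed.

Hypothesis A_fg : exists s, forall a, zspan s a.
Hypothesis A_tf : torsion_free.

Lemma int_functional d : d != 0 -> exists lam : {additive A -> int}, lam d != 0.
Proof.
move=> dN0; have [s sA] := A_fg.
have [] := @int_functional_span d s.
  by move=> n n0; apply: contraNneq dN0 => /(A_tf n0) ->.
move=> lam lamd lamB.
have sA' a : zspan (s ++ [:: d]) a.
  elim: (s) a (sA a) => [a ->|x t IHt a [n an]].
    exact: zspan0.
  by exists n; apply: IHt.
have lamB' : {morph lam : a b / a - b} by move=> a b; apply: lamB.
pose lamA := GRing.isZmodMorphism.Build A int lam lamB'.
by exists (HB.pack lam lamA : {additive A -> int}).
Qed.

Lemma mulrnI_tf n a b : (0 < n)%N -> a *+ n = b *+ n -> a = b.
Proof.
by move=> n0 /eqP; rewrite -subr_eq0 -mulrnBl => /eqP/(A_tf n0)/subr0_eq.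
Qed.

(** Take the largest [k] that divides [d]: a functional that is nonzero at [d] bounds it, since [k]
    divides [lam d]. *)
Lemma primitive_root d : d != 0 -> exists k p, [/\ (0 < k)%N, d = p *+ k &
  forall z K (n : int), (0 < K)%N -> z *+ K = d *~ n -> exists m : int, z = p *~ m].
Proof.
move=> dN0; have [lam lamd] := int_functional dN0.
pose P k := `[< exists p, d = p *+ k >].
have P1 : exists k, P k by exists 1%N; apply/asboolP; exists d.
have Ple k : P k -> (k <= `|lam d|)%N.
  move=> /asboolP[p dE]; apply: dvdn_leq; first by rewrite absz_gt0.
  by rewrite {}dE raddfMn -mulr_natr abszM natz /= dvdn_mull.
case: (ex_maxnP P1 Ple) => k /asboolP[p dE] kmax.
have k0 : (0 < k)%N by rewrite lt0n; apply: contraNneq dN0 => k0; rewrite dE k0 mulr0n.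
exists k, p; split=> // z K n K0 zK.
pose N := (n * k)%R; have {}zK : z *~ K = p *~ N by rewrite -pmulrn zK dE pmulrn -mulrzA mulrC.
pose g := gcdz K N; have g0 : (0 < `|g|)%N by rewrite /g /gcdz /= gcdn_gt0 K0.
have [K' KE] : exists K', K%:Z = K' * g by exists (K %/ g)%Z; rewrite divzK// dvdz_gcdl.
have [N' NE] : exists N', N = N' * g by exists (N %/ g)%Z; rewrite divzK// dvdz_gcdr.
have [u [v uv]] := Bezoutz K N.
have gE : g = Posz `|g| by rewrite /g /gcdz.
have {}zK : z *~ K' = p *~ N'.
  by apply: (mulrnI_tf g0); rewrite !pmulrn -!mulrzA -gE -KE -NE.
have uv1 : u * K' + v * N' = 1.
  apply: (@mulIf _ g); first by rewrite -absz_gt0.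
  by rewrite mulrDl -!mulrA -KE -NE uv mul1r.
(* By Bezout, [K'] divides [p], hence [K' * k] divides [d], and maximality of [k] leaves only
   [K' = 1]. *)
have pE : p = (p *~ u + z *~ v) *~ K'.
  rewrite mulrzDl -!mulrzA [v * K']mulrC [z *~ _]mulrzA zK -mulrzA -mulrzDr.
  by rewrite [N' * v]mulrC uv1 mulr1z.
have K'0 : 0 < K' by move: KE; rewrite gE; nia.
have K'1 : K' = 1.
  have /kmax : P (`|K'| * k)%N; last by rewrite -{2}[k]mul1n leq_pmul2r//; lia.
  apply/asboolP; exists (p *~ u + z *~ v).
  rewrite dE mulrnA [in LHS]pE; congr (_ *+ _); rewrite pmulrn; congr (_ *~ _); lia.
by exists N'; rewrite -zK K'1 mulr1z.
Qed.

End FinitelyGeneratedZmodule.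

(** * Torsion-free abelian subgroups of finite index *)

Lemma mem_zspan (A : zmodType) (s : seq A) x : x \in s -> zspan s x.
Proof.
elim: s => //= y s IHs; rewrite inE => /predU1P[->|/IHs sx].
  by exists 1%R; rewrite mulr1z subrr; apply: zspan0.
by exists 0%R; rewrite mulr0z subr0.
Qed.

Lemma zspan_map (A A' : zmodType) (phi : A -> A') (s : seq A) a :
  {morph phi : a b / (a - b)%R} -> zspan s a -> zspan (map phi s) (phi a).
Proof.
move=> phiB; elim: s a => [a ->|x s IHs a [n /IHs sa]] /=.
  by have := phiB 0%R 0%R; rewrite !subrr.
pose fA := GRing.isZmodMorphism.Build A A' phi phiB.
have phiMz : (phi (x *~ n) = phi x *~ n)%R.
  exact: (raddfMz (HB.pack phi fA : {additive A -> A'})).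
by exists n; rewrite -phiMz -phiB.
Qed.

Section SubgroupZmodule.
Variables (G : groupType) (N : set G).
Hypotheses (sN : subgroup N) (aN : abelian_subset N).

(** The [let]s keep both proofs in the type, so that the structures declared on it are determined by
    it. *)
Definition sub_zmod : Type := let _ := sN in let _ := aN in {x : G | `[< N x >]}.

HB.instance Definition _ := Choice.on sub_zmod.

Let mk x (Nx : N x) : sub_zmod := exist _ x (asboolT Nx).
Let valN (u : sub_zmod) : N (val u) := asboolW (valP u).

Let zero := mk (subgroup1 sN).
Let opp u := mk (subgroupV sN (valN u)).
Let add u v := mk (subgroupM sN (valN u) (valN v)).

Let addA : associative add. Proof. by move=> u v w; apply/val_inj; rewrite /= mulgA. Qed.
Let addC : commutative add.
Proof. by move=> u v; apply/val_inj/aN; rewrite inE; apply: valN. Qed.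
Let add0 : left_id zero add. Proof. by move=> u; apply/val_inj; rewrite /= mul1g. Qed.
Let addN : left_inverse zero opp add. Proof. by move=> u; apply/val_inj; rewrite /= mulVg. Qed.

HB.instance Definition _ := GRing.isZmodule.Build sub_zmod addA addC add0 addN.

Lemma abelian_subgroup_zmod : exists (A : zmodType) (iota : A -> G),
  [/\ {morph iota : a b / (a + b)%R >-> a * b}, injective iota & range iota = N].
Proof.
exists sub_zmod, (fun u : sub_zmod => val u); split; [by []|exact: val_inj|].
by apply/seteqP; split=> [_ [u _ <-]|x Nx]; [apply: valN|exists (mk Nx)].
Qed.

End SubgroupZmodule.

Section Schreier.
Variables (G : groupType) (N : set G).
Hypotheses (sN : subgroup N) (fN : finite_cosets N).

(* Schreier's generators [rep x * s / rep (x * s)]. *)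
Lemma finitely_generated_subgroup :
  finitely_generated G -> exists2 s : seq G, [set` s] `<=` N & N `<=` generated [set` s].
Proof.
move=> [S [fS genS]]; have [F [r [cl [clP rI]]]] := coset_repr sN fN.
pose rep x := r (cl x).
have repE x y : N (x / y) -> rep x = rep y.
  move=> Nxy; congr r; apply: rI.
  have := subgroupM sN (subgroupM sN (subgroupV sN (clP x)) Nxy) (clP y).
  by rewrite invgF divgKA divgKA.
have rep_mul x s : rep (rep x * s) = rep (x * s).
  by apply: repE; rewrite mulgKA -invgF; apply: (subgroupV sN (clP x)).
(* The representative [rep 1] may differ from [1]. Schreier's generators then yield only the
   conjugates by [rep 1] of elements of [N], and adding [rep 1] to [Y] undoes this conjugation. *)
pose Y := rep 1 |` [set p.1 * p.2 / rep (p.1 * p.2) | p in [set rep x | x in [set: G]] `*` S].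
have fY : finite_set Y.
  rewrite finite_setU; split=> //; apply/finite_image/finite_setX => //.
  apply: (@sub_finite_set _ _ [set r k | k in [set: F]]).
    by move=> _ [x _ <-]; exists (cl x).
  exact/finite_image/finite_finset.
have YN : Y `<=` N.
  move=> _ [->|[[_ s] [[x _ <-] _] <-]] /=.
    by have := subgroupV sN (clP 1); rewrite invgF divg1.
  exact: clP.
have /finite_seqP[s sY] := fY; exists s; rewrite -sY//.
suff PG g x : generated Y (rep x * g / rep (x * g)).
  move=> n Nn; have Y1 : generated Y (rep 1) by apply: sub_generated; left.
  have := PG n 1; rewrite mul1g.
  have -> : rep n = rep 1 by apply: repE; rewrite divg1.
  have sgY := @generated_subgroup _ Y => /(subgroupM sgY (subgroupV sgY Y1)) /(subgroupM sgY).
  by move=> /(_ _ Y1) /=; rewrite !mulgA mulVg mul1g mulgVK.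
have : generated S `<=` [set g | forall x, generated Y (rep x * g / rep (x * g))].
  apply: generated_min.
    have sgY := @generated_subgroup _ Y.
    apply/subgroupE; split=> [y|k h Pk Ph y].
      by rewrite !mulg1 mulgV; apply: subgroup1.
    have := subgroupM sgY (Pk y) (subgroupV sgY (Ph (y * k / h))).
    by rewrite !invgM !invgK !mulgA !mulgVK.
  move=> t St z; apply: sub_generated; right; exists (rep z, t); rewrite /= ?rep_mul//.
    by split=> //; exists z.
by rewrite genS; apply.
Qed.

End Schreier.

(* [iota] identifies the abelian group [A], written additively, with a normal
   subgroup of finite index of [G]. *)
Definition finite_index_embedding (G : groupType) (A : zmodType) (iota : A -> G) :=
  [/\ {morph iota : a b / (a + b)%R >-> a * b}, injective iota,
      normal_set (range iota) & finite_cosets (range iota)].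

Section Embedding.
Variables (G : groupType) (A : zmodType) (iota : A -> G).
Hypothesis iotaP : finite_index_embedding iota.

Let iotaD a b : iota (a + b)%R = iota a * iota b. Proof. by have [] := iotaP. Qed.

Lemma emb_inj : injective iota. Proof. by have [] := iotaP. Qed.

Lemma emb0 : iota 0%R = 1.
Proof. by apply: (mulgI (iota 0%R)); rewrite -iotaD addr0 mulg1. Qed.

Lemma embN a : iota (- a)%R = (iota a)^-1.
Proof. by apply: (mulgI (iota a)); rewrite -iotaD subrr mulgV emb0. Qed.

Lemma embB a b : iota (a - b)%R = iota a / iota b.
Proof. by rewrite iotaD embN. Qed.

Lemma embMn a n : iota (a *+ n)%R = iota a ^+ n.
Proof. by elim: n => [|n IHn]; rewrite ?mulr0n ?emb0// mulrS iotaD IHn expgS. Qed.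

Lemma emb_subgroup : subgroup (range iota).
Proof.
apply/subgroupE; split=> [|_ _ [a _ <-] [b _ <-]]; first by exists 0%R; rewrite ?emb0.
by exists (a - b)%R; rewrite ?embB.
Qed.

Lemma emb_conj g a : exists b, g * iota a / g = iota b.
Proof.
have [_ _ nA _] := iotaP.
by have [|b _ <-] := nA g (iota a); [exists a|exists b].
Qed.

Lemma emb_scale (M : nat) : (0 < M)%N -> (exists s : seq A, forall a, zspan s a) ->
  finite_cosets [set iota (a *+ M)%R | a in [set: A]].
Proof.
move=> M0 [s sA]; have [_ _ _ [F [f fP]]] := iotaP.
have [F' [f' f'P]] := zspan_mod s M0.
have [r rP] := fiber_repr 1 f.
have /choice[a aP] : forall x, exists a, x / r (f x) = iota a.
  by move=> x; have [|a _ <-] := fP x (r (f x)); [rewrite rP|exists a].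
(* A coset of the multiples of [M] is given by a coset of [A] and a residue modulo [M] of the
   component in [A]. *)
exists (F * F')%type, (fun x => (f x, f' (a x))) => x y [exy].
move=> /(f'P _ _ (sA _) (sA _))[c cE].
by exists c => //; rewrite -cE embB -!aP exy mulgKA.
Qed.

End Embedding.

Lemma torsion_free_embedding (G : groupType) :
  finitely_generated G -> virtually_abelian G ->
  exists (A : zmodType) (iota : A -> G), [/\ finite_index_embedding iota,
    exists s : seq A, forall a, zspan s a & torsion_free A].
Proof.
move=> fgG [H [sH fiH aH]].
have [N [sN NH nN fN]] := normal_core sH (finite_index_cosets sH fiH).
have aN : abelian_subset N.
  by move=> x y; rewrite !inE => /NH Hx /NH Hy; apply: aH; rewrite inE.
have [A0 [iota0 [D0 I0 R0]]] := abelian_subgroup_zmod sN aN.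
have E0 : finite_index_embedding iota0 by split; rewrite ?R0.
have [s0 s0A] : exists s : seq A0, forall a, zspan s a.
  have [s sN' Ns] := finitely_generated_subgroup sN fN fgG.
  have /choice[g gP] : forall x, exists a, N x -> iota0 a = x.
    move=> x; have [|nx] := pselect (N x); last by exists 0%R.
    by rewrite -R0 => -[a _ <-]; exists a.
  exists (map g s) => a; have : range iota0 (iota0 a) by exists a.
  rewrite R0 => /Ns; have : generated [set` s] `<=` iota0 @` zspan (map g s).
    apply: generated_min => [|x /= sx].
      apply/subgroupE; split=> [|_ _ [b sb <-] [c sc <-]].
        by exists 0%R; [apply: zspan0|rewrite (emb0 E0)].
      by exists (b - c)%R; [apply: zspanB|rewrite (embB E0)].
    by exists (g x); [apply/mem_zspan/map_f|apply/gP/sN'].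
  by move=> sub /sub [b sb /I0 <-].
have [M M0 MP] := torsion_exponent s0.
(* Since [M] kills all torsion of [A0], the multiples of [M] form a torsion-free subgroup, still
   normal and of finite index. *)
pose N' := [set iota0 (a *+ M)%R | a in [set: A0]].
have N'N : N' `<=` N by move=> _ [a _ <-]; rewrite -R0; exists (a *+ M)%R.
have sN' : subgroup N'.
  apply/subgroupE; split=> [|_ _ [b _ <-] [c _ <-]].
    by exists 0%R; rewrite ?mul0rn ?(emb0 E0).
  by exists (b - c)%R; rewrite ?mulrnBl ?(embB E0).
have aN' : abelian_subset N'.
  by move=> x y; rewrite !inE => /N'N Nx /N'N Ny; apply: aN; rewrite inE.
have [A [iota [D I R]]] := abelian_subgroup_zmod sN' aN'.
have E : finite_index_embedding iota.
  split; rewrite ?R//; last by apply: emb_scale => //; exists s0.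
  move=> g _ [a _ <-]; have [b bE] := emb_conj E0 g a; exists b => //.
  by rewrite !(embMn E0) -bE conj_powers.
have /choice[phi phiE] : forall a, exists b, iota b = iota0 (a *+ M)%R.
  by move=> a; have : N' (iota0 (a *+ M)%R); [exists a|rewrite -R => -[b _ <-]; exists b].
have phiB : {morph phi : a b / (a - b)%R}.
  by move=> a b; apply: I; rewrite (embB E) !phiE mulrnBl (embB E0).
have phiS b : exists a, phi a = b.
  have : range iota (iota b) by exists b.
  by rewrite R => -[a _ aE]; exists a; apply: I; rewrite phiE.
exists A, iota; split=> //.
  by exists (map phi s0) => b; have [a <-] := phiS b; apply: zspan_map.
move=> b n n0 bn; have [a aE] := phiS b.
have an : (a *+ M *+ n = 0)%R.
  by apply: I0; rewrite (embMn E0) -phiE aE -(embMn E) bn (emb0 E) (emb0 E0).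
apply: I; rewrite -aE phiE (MP a (M * n)%N) ?muln_gt0 ?M0 ?mulrnA//.
by rewrite (emb0 E) (emb0 E0).
Qed.

(** * Virtually cyclic groups *)

(** Exponents are natural numbers here, so an integral power is written as a quotient of two
    powers. *)
Lemma cyclic_powers (G : groupType) (x y : G) :
  generated [set x] y -> exists m n, y = x ^+ m / x ^+ n.
Proof.
apply: (generated_min (H := [set y | exists m n, y = x ^+ m / x ^+ n])); last first.
  by move=> _ ->; exists 1%N, 0%N; rewrite expg1 expg0 divg1.
apply/subgroupE; split=> [|_ _ [m [n ->]] [m' [n' ->]]].
  by exists 0%N, 0%N; rewrite divg1.
exists (m + n')%N, (m' + n)%N; rewrite invgF !expgnDr invgM !mulgA; congr (_ / _).
rewrite -!mulgA; congr (_ * _).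
by apply: commute_sym; apply: commuteV; apply: commuteX2.
Qed.

Lemma virtually_cyclic_powers (G : groupType) : virtually_cyclic G ->
  exists x : G, forall y, exists K m n, (0 < K)%N /\ y ^+ K = x ^+ m / x ^+ n.
Proof.
move=> [H [sH /(finite_index_cosets sH) fH [x HE]]]; exists x => y.
have [K K0] := finite_cosets_powers y sH fH; rewrite HE => /cyclic_powers[m [n ymn]].
by exists K, m, n.
Qed.

(* Replacing [A] by [k A], where [e = k p] with [p] primitive, cuts the
   intersection with [G0] down to the subgroup generated by [e]. *)
Lemma cyclic_intersection (G0 G : groupType) (j : group_hom G0 G) (A : zmodType)
    (iota : A -> G) (e : G0) :
  injective j -> finite_index_embedding iota -> (exists s : seq A, forall a, zspan s a) ->
  torsion_free A -> e != 1 -> range iota (j e) ->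
  (forall y, exists K m n, (0 < K)%N /\ y ^+ K = e ^+ m / e ^+ n) ->
  exists iota' : A -> G, [/\ finite_index_embedding iota', range iota' (j e) &
    forall y, range iota' (j y) -> exists m n, y = e ^+ m / e ^+ n].
Proof.
move=> j_inj E sA tfA e1 [d _ dE] eP.
have d0 : d != 0%R.
  by apply: contraNneq e1 => d0; rewrite -(inj_eq j_inj) gmulf1 -dE d0 (emb0 E).
have [k [p [k0 dp pP]]] := primitive_root sA tfA d0.
exists (fun a => iota (a *+ k)%R); split.
- have [D I N _] := E; split; last exact: emb_scale.
  + by move=> a b; rewrite mulrnDl D.
  + by move=> a b /I; apply: mulrnI_tf.
  + move=> g _ [a _ <-]; have [b bE] := emb_conj E g a; exists b => //.
    by rewrite !(embMn E) -bE conj_powers.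
- by exists p => //; rewrite -dp.
move=> y [a _ aE]; have [K [m [n [K0 yK]]]] := eP y.
(* As [y ^+ K] is an integral power of [e], [a] is a rational multiple of [d]. By primitivity it is
   an integral multiple of [p], so [a *+ k] is one of [d]. *)
have : (a *+ (k * K) = d *~ (m%:Z - n%:Z))%R.
  apply: (emb_inj E); rewrite mulrnA (embMn E) aE mulrzBr (embB E) -!pmulrn !(embMn E) dE.
  by rewrite -!gmulfXn yK gmulfF.
move=> /(pP _ _ _ _) -/(_ _)[|l al]; first by rewrite muln_gt0 k0.
have yE : j y = iota (d *~ l)%R.
  by rewrite -aE al dp !pmulrn -!mulrzA mulrC.
case: l yE {al} => l; rewrite ?NegzE ?mulrNz -?pmulrn ?(embN E) (embMn E) dE => yE.
  by exists l, 0%N; rewrite divg1; apply: j_inj; rewrite yE gmulfXn.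
by exists 0%N, l.+1; rewrite expg0 div1g; apply: j_inj; rewrite yE gmulfV gmulfXn.
Qed.

(** * Wreath products with finite symmetric groups *)

Section Wreath.
Variables (I : finType) (B : zmodType).

Definition wreath : Type := {perm I} * {ffun I -> B}.

HB.instance Definition _ := Choice.on wreath.

Let one : wreath := (1, [ffun=> 0%R]).
(** Permutations compose from left to right, so homomorphisms to this group amount to right actions
    on [I] together with cocycles in [B]. *)
Let mul (x y : wreath) : wreath := (x.1 * y.1, [ffun i => (x.2 i + y.2 (x.1 i))%R]).
Let inv (x : wreath) : wreath := (x.1^-1, [ffun i => (- x.2 (x.1^-1%g i))%R]).

Let mulA : associative mul.
Proof.
move=> x y z; congr pair; rewrite /= ?mulgA//.
by apply/ffunP => i; rewrite !ffunE /= permM addrA.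
Qed.

Let mul1 : left_id one mul.
Proof.
move=> [s f]; congr pair; rewrite /= ?mul1g//.
by apply/ffunP => i; rewrite !ffunE /= perm1 add0r.
Qed.

Let mulr1 : right_id one mul.
Proof.
move=> [s f]; congr pair; rewrite /= ?mulg1//.
by apply/ffunP => i; rewrite !ffunE /= addr0.
Qed.

Let mulV : left_inverse one inv mul.
Proof.
move=> [s f]; congr pair; rewrite /= ?mulVg//.
by apply/ffunP => i; rewrite !ffunE /= addNr.
Qed.

Let mulrV : right_inverse one inv mul.
Proof.
move=> [s f]; congr pair; rewrite /= ?mulgV//.
by apply/ffunP => i; rewrite !ffunE /= permK subrr.
Qed.

HB.instance Definition _ := isGroup.Build wreath mulA mul1 mulr1 mulV mulrV.

Lemma wreath_mulE (x y : wreath) :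
  x * y = (x.1 * y.1, [ffun i => (x.2 i + y.2 (x.1 i))%R]).
Proof. by []. Qed.

Lemma wreath_oneE : 1 = (1, [ffun=> 0%R]) :> wreath.
Proof. by []. Qed.

Definition wreath_base : set wreath := [set x | x.1 = 1].

Lemma wreath_base_subgroup : subgroup wreath_base.
Proof.
apply/subgroupE; split=> // x y; rewrite /wreath_base /= => -> ->.
by rewrite mulgV.
Qed.

Lemma wreath_base_abelian : abelian_subset wreath_base.
Proof.
move=> x y; rewrite !inE /wreath_base /= => x1 y1.
rewrite !wreath_mulE x1 y1; congr pair.
by apply/ffunP => i; rewrite !ffunE /= !perm1 addrC.
Qed.

Lemma wreath_base_cosets : finite_cosets wreath_base.
Proof. by exists {perm I}, fst => x y exy; rewrite /wreath_base /= exy mulgV. Qed.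

Lemma wreath_hom (G : groupType) (act : I -> G -> I) (coc : I -> G -> B) :
  (forall i, act i 1 = i) -> (forall i g h, act i (g * h) = act (act i g) h) ->
  (forall i g h, coc i (g * h) = (coc i g + coc (act i g) h)%R) ->
  exists f : group_hom G wreath, forall g i, (f g).1 i = act i g /\ (f g).2 i = coc i g.
Proof.
move=> act1 actM cocM.
have act_inj g : injective (act^~ g).
  by apply: (can_inj (g := act^~ g^-1)) => i; rewrite -actM mulgV.
pose f g : wreath := (perm (act_inj g), [ffun i => coc i g]).
have coc1 i : coc i 1 = 0%R.
  by apply: (addrI (coc i 1)); rewrite -{2}(act1 i) -cocM mulg1 addr0.
have f1 : f 1 = 1.
  congr pair; first by apply/permP => i; rewrite permE perm1.
  by apply/ffunP => i; rewrite !ffunE.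
have fM : {morph f : x y / x * y}.
  move=> g h; congr pair; first by apply/permP => i; rewrite !permE /= !permE.
  by apply/ffunP => i; rewrite !ffunE /= permE.
pose fA := isUMagmaMorphism.Build G wreath f (conj f1 fM).
exists (HB.pack f fA : group_hom G wreath) => g i /=.
by rewrite permE ffunE.
Qed.

End Wreath.

(** * Induced homomorphisms to wreath products *)

(* The products [t u * j (r k)] are representatives of the right cosets of the
   image of [A]: [t] runs over the double cosets of the images of [A] and [G0],
   and [r] over the cosets in [G0] of the preimage of [A]. *)
Lemma transversal (G0 G : groupType) (j : group_hom G0 G) (A : zmodType)
    (iota : A -> G) (Q : finType) (r : Q -> G0) (cl : G0 -> Q) :
  finite_index_embedding iota ->
  (forall x, range iota (j (x / r (cl x)))) ->
  (forall k l, range iota (j (r k / r l)) -> k = l) ->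
  exists (T : finType) (t : T -> G) (pi : G -> T * Q) (al : G -> A),
    (forall g, g = iota (al g) * (t (pi g).1 * j (r (pi g).2))) /\
    (forall a i, al (iota a * (t i.1 * j (r i.2))) = a /\
                 pi (iota a * (t i.1 * j (r i.2))) = i).
Proof.
move=> E clP rI; have [_ _ _ [F [f fP]]] := E; have sA := emb_subgroup E.
have nA g a : range iota a -> range iota (g * a / g) by have [_ _ + _] := E; apply.
pose R x y := exists a h, range iota a /\ x = a * y * j h.
have [T [t [cT [cTP tI]]]] : exists (T : finType) (t : T -> G) (cT : G -> T),
    (forall x, R x (t (cT x))) /\ (forall u v, R (t u) (t v) -> u = v).
  apply: (@finite_classes _ R _ f).
  - by move=> x; exists 1, 1; rewrite gmulf1 mulg1 mul1g; split=> //; apply: subgroup1.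
  - move=> x y [a [h [Aa ->]]]; exists a^-1, h^-1.
    by rewrite gmulfV !mulgA mulgK mulVg mul1g; split=> //; apply: subgroupV.
  - move=> x y z [a [h [Aa ->]]] [b [k [Ab ->]]]; exists (a * b), (k * h).
    by rewrite gmulfM !mulgA; split=> //; apply: subgroupM.
  - move=> x y /fP Axy; exists (x / y), 1.
    by rewrite gmulf1 mulg1 mulgVK.
have dec g : exists p : A * (T * Q), g = iota p.1 * (t p.2.1 * j (r p.2.2)).
  have [b [h [[a _ aE] gE]]] := cTP g; have [c _ cE] := clP h.
  (* Normality moves the factor in [A] to the left of [t]. *)
  have [d dE] := emb_conj E (t (cT g)) c.
  exists ((a + d)%R, (cT g, cl h)) => /=; have [-> _ _ _] := E.
  rewrite -dE cE aE gmulfF !mulgA mulgVK {1}gE.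
  by rewrite mulgVK.
have /choice[p pP] := dec.
exists T, t, (fun g => (p g).2), (fun g => (p g).1); split=> // a [u k].
have := pP (iota a * (t u * j (r k))); move: (p _) => [b [v l]] /= eq1.
(* Comparing two decompositions puts [t u] and [t v] in one double coset. Once [u = v], normality
   puts [r k] and [r l] in one coset. *)
have eq2 : t u = iota (- a + b)%R * t v * j (r l / r k).
  have [-> _ _ _] := E; rewrite (embN E) -mulgA gmulfF; apply: (mulgI (iota a)).
  rewrite !mulgA mulgV mul1g -!mulgA; apply: (mulIg (j (r k))).
  by rewrite -!mulgA mulVg mulg1.
have uv : u = v.
  by apply: tI; exists (iota (- a + b)%R), (r l / r k); split=> //; exists (- a + b)%R.
move: eq1 eq2; rewrite -{}uv => eq1 eq2.
have kl : k = l.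
  apply: rI; have -> : j (r k / r l) = (t u)^-1 * iota (- a + b)%R / (t u)^-1.
    rewrite invgK -mulgA (_ : iota _ * t u = t u * j (r k / r l)) ?mulKg//.
    apply: (mulIg (j (r l / r k))).
    by rewrite -eq2 -mulgA -gmulfM divgKA mulgV gmulf1 mulg1.
  by apply: nA; exists (- a + b)%R.
by move: eq1; rewrite -{}kl => /mulIg/(emb_inj E) ->.
Qed.

Section InducedAction.
Variables (G : groupType) (A B : zmodType) (iota : A -> G) (I J : finType).
Variables (s : I -> G) (pi : G -> I) (al : G -> A).
(** [pr z] is the place of [z] in its copy of [I], and [put z i] is the element at place [i] of the
    same copy. *)
Variables (pr : J -> I) (put : J -> I -> J) (phi : J -> A -> B).
Hypothesis E : finite_index_embedding iota.
Hypothesis sP : forall g, g = iota (al g) * s (pi g).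
Hypothesis sU : forall a i, al (iota a * s i) = a /\ pi (iota a * s i) = i.
Hypothesis pr_put : forall z i, pr (put z i) = i.
Hypothesis put_pr : forall z, put z (pr z) = z.
Hypothesis put_put : forall z i i', put (put z i) i' = put z i'.
Hypothesis phi_put : forall z i, phi (put z i) = phi z.
Hypothesis phiD : forall z a b, phi z (a + b)%R = (phi z a + phi z b)%R.

(* [J] is a union of copies of the set [I] of right cosets. The action on a copy
   is by right multiplication; its cocycle is the Frobenius one, pushed forward
   by [phi]. *)
Lemma induced_hom : exists f : group_hom G (wreath J B),
  forall g z a i, s (pr z) * g = iota a * s i ->
    (f g).1 z = put z i /\ (f g).2 z = phi z a.
Proof.
have [D _ _ _] := E.
have step i g h : pi (s i * (g * h)) = pi (s (pi (s i * g)) * h) /\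
    al (s i * (g * h)) = (al (s i * g) + al (s (pi (s i * g)) * h))%R.
  set x := s _ * g; set y := s (pi x) * h.
  have -> : s i * (g * h) = iota (al x + al y)%R * s (pi y).
    by rewrite D -mulgA -sP /y !mulgA -sP.
  by have [-> ->] := sU (al x + al y)%R (pi y).
have unit_s i : pi (s i * 1) = i.
  by have [_] := sU 0%R i; rewrite (emb0 E) mul1g mulg1.
pose act z g := put z (pi (s (pr z) * g)).
pose coc z g := phi z (al (s (pr z) * g)).
have [||| f fE] := @wreath_hom J B G act coc.
- by move=> z; rewrite /act unit_s put_pr.
- by move=> z g h; rewrite /act pr_put put_put; have [-> _] := step (pr z) g h.
- move=> z g h; rewrite /coc /act pr_put phi_put -phiD.
  by have [_ ->] := step (pr z) g h.
exists f => g z a i eq1; have [-> ->] := fE g z.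
by rewrite /act /coc eq1; have [-> ->] := sU a i.
Qed.

(** An element of the kernel fixes [z0] and has zero cocycle there, so right multiplication by it
    fixes the representative [s (pr z0)]. *)
Lemma induced_hom_inj (f : group_hom G (wreath J B)) (z0 : J) :
  (forall g z a i, s (pr z) * g = iota a * s i ->
    (f g).1 z = put z i /\ (f g).2 z = phi z a) ->
  (forall z a, phi z a = 0%R -> a = 0%R) -> injective f.
Proof.
move=> fE phi0; apply: gmulf_inj => g fg.
set x := s (pr z0) * g; have [] := fE g z0 _ _ (sP x).
rewrite fg wreath_oneE /= perm1 ffunE => z0E /esym/phi0 a0.
have iE : pi x = pr z0 by rewrite z0E pr_put.
have := sP x; rewrite a0 iE (emb0 E) mul1g => xE.
by apply: (mulgI (s (pr z0))); rewrite -/x xE mulg1.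
Qed.

End InducedAction.

Section Matching.
Variables (G0 G1 G2 : groupType) (j1 : group_hom G0 G1) (j2 : group_hom G0 G2).
Variables (A1 A2 B : zmodType) (iota1 : A1 -> G1) (iota2 : A2 -> G2).
(** For infinite [G0], [phi1 x q] plays the role of tensoring with the conjugate of [e] by
    [x * j2 q], and symmetrically for [phi2]. *)
Variables (phi1 : G2 -> G0 -> A1 -> B) (phi2 : G1 -> G0 -> A2 -> B).
Hypotheses (E1 : finite_index_embedding iota1) (E2 : finite_index_embedding iota2).
Hypothesis same_preimage : forall y, range iota1 (j1 y) <-> range iota2 (j2 y).
Hypothesis phi1D : forall x q a b, phi1 x q (a + b)%R = (phi1 x q a + phi1 x q b)%R.
Hypothesis phi2D : forall x q a b, phi2 x q (a + b)%R = (phi2 x q a + phi2 x q b)%R.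
Hypothesis phi1_eq0 : forall x q a, phi1 x q a = 0%R -> a = 0%R.
Hypothesis phi2_eq0 : forall x q a, phi2 x q a = 0%R -> a = 0%R.
Hypothesis phi12 : forall x1 x2 q y a1 a2,
  x1 * j1 y / x1 = iota1 a1 -> x2 * j2 y / x2 = iota2 a2 ->
  phi1 x2 q a1 = phi2 x1 q a2.

(* The index set is [T1 * T2 * (Q * Q)]. The group [G1] acts on [T1] and the
   first copy of [Q], and [G2] on [T2] and the same copy of [Q], so that the two
   actions of [G0] agree; the other copy of [Q] is the parameter of the
   embeddings [phi1] and [phi2]. *)
Lemma amalgam_wreath : exists (J : finType) (f1 : group_hom G1 (wreath J B))
    (f2 : group_hom G2 (wreath J B)),
  [/\ injective f1, injective f2 & f1 \o j1 =1 f2 \o j2].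
Proof.
pose C := j1 @^-1` range iota1.
have sC : subgroup C by apply/preimage_subgroup/emb_subgroup.
have fC : finite_cosets C by apply: finite_cosets_preimage; have [] := E1.
have [Q [r [cl [clP rI]]]] := coset_repr sC fC.
have [T1 [t1 [pi1 [al1 [P1 U1]]]]] := transversal E1 clP rI.
have clP2 x : range iota2 (j2 (x / r (cl x))) by apply/same_preimage/clP.
have rI2 k l : range iota2 (j2 (r k / r l)) -> k = l by move/same_preimage/rI.
have [T2 [t2 [pi2 [al2 [P2 U2]]]]] := transversal E2 clP2 rI2.
pose J := (T1 * T2 * (Q * Q))%type.
pose put1 (z : J) (i : T1 * Q) : J := ((i.1, z.1.2), (i.2, z.2.2)).
pose put2 (z : J) (i : T2 * Q) : J := ((z.1.1, i.1), (i.2, z.2.2)).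
have [|||||f1 f1E] := @induced_hom _ _ B iota1 _ J (fun i => t1 i.1 * j1 (r i.2))
  pi1 al1 (fun z => (z.1.1, z.2.1)) put1 (fun z => phi1 (t2 z.1.2) (r z.2.2)) E1 P1 U1.
- by move=> z [u k].
- by move=> [[u v] [k l]].
- by [].
- by [].
- by move=> z a b; apply: phi1D.
have [|||||f2 f2E] := @induced_hom _ _ B iota2 _ J (fun i => t2 i.1 * j2 (r i.2))
  pi2 al2 (fun z => (z.1.2, z.2.1)) put2 (fun z => phi2 (t1 z.1.1) (r z.2.2)) E2 P2 U2.
- by move=> z [u k].
- by move=> [[u v] [k l]].
- by [].
- by [].
- by move=> z a b; apply: phi2D.
have z0 : J := (((pi1 1).1, (pi2 1).1), ((pi1 1).2, (pi1 1).2)).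
exists J, f1, f2; split.
- apply: (induced_hom_inj E1 P1 _ z0 f1E) => [z [u k]//|z a]; exact: phi1_eq0.
- apply: (induced_hom_inj E2 P2 _ z0 f2E) => [z [u k]//|z a]; exact: phi2_eq0.
move=> y /=.
suff fE z : (f1 (j1 y)).1 z = (f2 (j2 y)).1 z /\ (f1 (j1 y)).2 z = (f2 (j2 y)).2 z.
  rewrite [LHS]surjective_pairing [RHS]surjective_pairing; congr pair.
    by apply/permP => z; have [] := fE z.
  by apply/ffunP => z; have [] := fE z.
case: z => [[u v] [k l]].
(* Both actions of [y] move [k] to [k']. The conjugates of the discrepancy [c] by [t1 u] and [t2 v]
   give the two cocycle values, which [phi12] identifies. *)
pose k' := cl (r k * y); pose c := r k * y / r k'.
have cy : r k * y = c * r k' by rewrite mulgVK.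
have [a1 a1E] : exists a, t1 u * j1 c / t1 u = iota1 a.
  by have [a _ <-] := clP (r k * y); apply: emb_conj.
have [a2 a2E] : exists a, t2 v * j2 c / t2 v = iota2 a.
  by have [a _ <-] := clP2 (r k * y); apply: emb_conj.
have [|-> ->] := f1E (j1 y) ((u, v), (k, l)) a1 (u, k').
  by rewrite /= -a1E -mulgA -gmulfM cy gmulfM !mulgA mulgVK.
have [|-> ->] := f2E (j2 y) ((u, v), (k, l)) a2 (v, k').
  by rewrite /= -a2E -mulgA -gmulfM cy gmulfM !mulgA mulgVK.
by split=> //=; apply: phi12 a1E a2E.
Qed.

End Matching.

(** * Homomorphisms that agree on a virtually cyclic [G0] *)

Lemma embedding_powers (G0 : groupType) (A : zmodType) (G : groupType) (iota : A -> G)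
    (j : group_hom G0 G) (e y : G0) (m n : nat) (x : G) (d a : A) :
  finite_index_embedding iota -> y = e ^+ m / e ^+ n -> x * j e / x = iota d ->
  x * j y / x = iota a -> a = (d *~ (m%:Z - n%:Z))%R.
Proof.
move=> E -> ed ea; apply: (emb_inj E).
rewrite -ea mulrzBr (embB E) -!pmulrn !(embMn E) -ed -!conj_powers gmulfF !gmulfXn.
by rewrite !invgM !invgK !mulgA mulgVK.
Qed.

Lemma conj_neq1 (G0 G : groupType) (h : group_hom G0 G) (A : zmodType) (iota : A -> G)
    (e q : G0) (x : G) (a : A) :
  finite_index_embedding iota -> injective h -> e != 1 ->
  x * h (q * e / q) / x = iota a -> a != 0%R.
Proof.
move=> E h_inj eN1 ea; apply: contraNneq eN1 => a0; move: ea; rewrite a0 (emb0 E).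
move=> /(congr1 (fun z => x^-1 * z * x)); rewrite !mulgA mulVg mul1g mulgVK mulg1 mulVg => h1.
have /h_inj : h (q * e / q) = h 1 by rewrite h1 gmulf1.
move=> /(congr1 (fun z => q^-1 * z * q)).
by rewrite !mulgA mulVg mul1g mulgVK mulg1 mulVg => ->.
Qed.

Section Amalgam.
Variables (G0 G1 G2 : groupType) (j1 : group_hom G0 G1) (j2 : group_hom G0 G2).
Hypotheses (j1_inj : injective j1) (j2_inj : injective j2).
Hypotheses (fg1 : finitely_generated G1) (va1 : virtually_abelian G1).
Hypotheses (fg2 : finitely_generated G2) (va2 : virtually_abelian G2).
Hypothesis vc0 : virtually_cyclic G0.

Lemma amalgam_embedding : exists (J : finType) (B : zmodType)
    (f1 : group_hom G1 (wreath J B)) (f2 : group_hom G2 (wreath J B)),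
  [/\ injective f1, injective f2 & f1 \o j1 =1 f2 \o j2].
Proof.
have [A1 [iota1 [E1 sA1 tfA1]]] := torsion_free_embedding fg1 va1.
have [A2 [iota2 [E2 sA2 tfA2]]] := torsion_free_embedding fg2 va2.
have [x xP] := virtually_cyclic_powers vc0.
have sC1 := preimage_subgroup j1 (emb_subgroup E1).
have sC2 := preimage_subgroup j2 (emb_subgroup E2).
(* The intersection provides one power of [x] that lies in both [A1] and [A2]. *)
have sC : subgroup (j1 @^-1` range iota1 `&` j2 @^-1` range iota2).
  apply/subgroupE; split=> [|y z [y1 y2] [z1 z2]]; first by split; apply: subgroup1.
  by split; apply: subgroupF.
have fC : finite_cosets (j1 @^-1` range iota1 `&` j2 @^-1` range iota2).
  have [F1 [f1 f1P]] : finite_cosets (j1 @^-1` range iota1).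
    by apply: finite_cosets_preimage; have [] := E1.
  have [F2 [f2 f2P]] : finite_cosets (j2 @^-1` range iota2).
    by apply: finite_cosets_preimage; have [] := E2.
  exists (F1 * F2)%type, (fun y => (f1 y, f2 y)) => y z [e1 e2].
  by split; [apply: f1P|apply: f2P].
have [n n0 [xn1 xn2]] := finite_cosets_powers x sC fC.
have {}xP y : exists K m l, (0 < K)%N /\ y ^+ K = (x ^+ n) ^+ m / (x ^+ n) ^+ l.
  have [K [m [l [K0 yK]]]] := xP y; exists (K * n)%N, m, l.
  by rewrite muln_gt0 K0 expgnA yK expgF_commute -!expgnA ![(n * _)%N]mulnC.
move: (x ^+ n) xn1 xn2 xP => e xn1 xn2 xP.
(* If [e = 1], every element of [G0] has finite order, so only [1] can lie in the torsion-free [A1]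
   or [A2]. *)
have [e1|eN1] := eqVneq e 1.
  have tfC (G : groupType) (A : zmodType) (iota : A -> G) (h : group_hom G0 G) y :
      finite_index_embedding iota -> torsion_free A -> injective h ->
      range iota (h y) -> y = 1.
    move=> E tfA h_inj [a _ aE]; have [K [m [l [K0 yK]]]] := xP y.
    have /(tfA _ _ K0) a0 : (a *+ K = 0)%R.
      by apply: (emb_inj E); rewrite (embMn E) aE -gmulfXn yK e1 !expg1n mulgV gmulf1 (emb0 E).
    by apply: h_inj; rewrite -aE a0 (emb0 E) gmulf1.
  have tfC1 y : range iota1 (j1 y) -> y = 1 by apply: tfC.
  have tfC2 y : range iota2 (j2 y) -> y = 1 by apply: tfC.
  have [||||||J [f1 [f2 fP]]] := @amalgam_wreath _ _ _ j1 j2 _ _ (A1 * A2)%type iota1 iota2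
    (fun _ _ a => (a, 0%R)) (fun _ _ a => (0%R, a)) E1 E2;
    last by exists J, (A1 * A2)%type, f1, f2.
  - move=> y; split=> [/tfC1|/tfC2] ->; rewrite gmulf1; exists 0%R => //.
      exact: emb0 E2.
    exact: emb0 E1.
  - by move=> _ _ a b; congr pair; rewrite addr0.
  - by move=> _ _ a b; congr pair; rewrite addr0.
  - by move=> _ _ a [].
  - by move=> _ _ a [].
  move=> x1 x2 _ y a1 a2 ya1 ya2.
  have y1 : y = 1.
    apply: tfC1; have [a aE] := emb_conj E1 x1^-1 a1; exists a => //.
    by rewrite -aE -ya1 invgK !mulgA mulVg mul1g mulgVK.
  congr pair; [apply: (emb_inj E1)|apply/esym/(emb_inj E2)].
    by rewrite -ya1 y1 gmulf1 mulg1 mulgV (emb0 E1).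
  by rewrite -ya2 y1 gmulf1 mulg1 mulgV (emb0 E2).
have [iota1' [E1' e_1 gen1]] := cyclic_intersection j1_inj E1 sA1 tfA1 eN1 xn1 xP.
have [iota2' [E2' e_2 gen2]] := cyclic_intersection j2_inj E2 sA2 tfA2 eN1 xn2 xP.
have range_conj (G : groupType) (A : zmodType) (iota : A -> G) g x' :
    finite_index_embedding iota -> range iota x' -> exists a, g * x' / g = iota a.
  by move=> E [a _ <-]; apply: emb_conj.
have /choice[w1 w1P] (p : G1 * G0) : exists a, p.1 * j1 (p.2 * e / p.2) / p.1 = iota1' a.
  have [a aE] := range_conj _ _ _ (p.1 * j1 p.2) _ E1' e_1.
  by exists a; rewrite -aE gmulfF gmulfM invgM !mulgA.
have /choice[w2 w2P] (p : G2 * G0) : exists a, p.1 * j2 (p.2 * e / p.2) / p.1 = iota2' a.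
  have [a aE] := range_conj _ _ _ (p.1 * j2 p.2) _ E2' e_2.
  by exists a; rewrite -aE gmulfF gmulfM invgM !mulgA.
pose B : zmodType := {additive A1 -> int} * {additive A2 -> int} -> int.
pose phi1 x2 q (a : A1) : B := fun lm => (lm.1 a * lm.2 (w2 (x2, q)))%R.
pose phi2 x1 q (a : A2) : B := fun lm => (lm.1 (w1 (x1, q)) * lm.2 a)%R.
have [||||||J [f1 [f2 fP]]] := @amalgam_wreath _ _ _ j1 j2 _ _ B iota1' iota2'
  phi1 phi2 E1' E2'; last by exists J, B, f1, f2.
- have sub (G G' : groupType) (A A' : zmodType) (iota : A -> G) (iota' : A' -> G')
      (h : group_hom G0 G) (h' : group_hom G0 G') :
      (forall y, range iota (h y) -> exists m n, y = e ^+ m / e ^+ n) ->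
      finite_index_embedding iota' -> range iota' (h' e) ->
      forall y, range iota (h y) -> range iota' (h' y).
    move=> gen E e' y /gen[m [l ->]]; have sE := emb_subgroup E.
    rewrite gmulfF !gmulfXn.
    by apply: (subgroupF sE); apply: subgroupX.
  by move=> y; split; apply: sub.
- by move=> x2 q a b; apply/funext => -[lam mu]; rewrite /phi1 /= raddfD mulrDl.
- by move=> x1 q a b; apply/funext => -[lam mu]; rewrite /phi2 /= raddfD mulrDr.
(* Evaluate at a pair of functionals that are nonzero at [a] and at the conjugate of [e]; the
   product of the two values is nonzero. *)
- move=> x2 q a phi0; apply: contrapT => /eqP /(int_functional sA1 tfA1)[lam lamN0].
  have /(int_functional sA2 tfA2)[mu muN0] := conj_neq1 E2' j2_inj eN1 (w2P (x2, q)).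
  have /eqP := congr1 (fun f => f (lam, mu)) phi0.
  by rewrite /phi1 /= mulf_eq0 (negPf lamN0) (negPf muN0).
- move=> x1 q a phi0; apply: contrapT => /eqP /(int_functional sA2 tfA2)[mu muN0].
  have /(int_functional sA1 tfA1)[lam lamN0] := conj_neq1 E1' j1_inj eN1 (w1P (x1, q)).
  have /eqP := congr1 (fun f => f (lam, mu)) phi0.
  by rewrite /phi2 /= mulf_eq0 (negPf lamN0) (negPf muN0).
move=> x1 x2 q y a1 a2 ya1 ya2.
(* Both [y] and [q * e / q] are integral powers of [e]. With [d1] and [d2] the conjugates of [e] by
   [x1] and [x2], both sides become the same integer times [lam d1 * mu d2]. *)
have pow1 z g a : g * j1 z / g = iota1' a -> exists m l, z = e ^+ m / e ^+ l.
  move=> za; apply: gen1; have [b bE] := emb_conj E1' g^-1 a; exists b => //.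
  by rewrite -bE -za invgK !mulgA mulVg mul1g mulgVK.
have [m [l ye]] := pow1 _ _ _ ya1.
have [m' [l' qe]] := pow1 _ _ _ (w1P (x1, q)).
have [d1 d1E] := range_conj _ _ _ x1 _ E1' e_1.
have [d2 d2E] := range_conj _ _ _ x2 _ E2' e_2.
apply/funext => -[lam mu]; rewrite /phi1 /phi2 /=.
rewrite (embedding_powers E1' ye d1E ya1) (embedding_powers E2' ye d2E ya2).
rewrite (embedding_powers E1' qe d1E (w1P (x1, q))).
rewrite (embedding_powers E2' qe d2E (w2P (x2, q))).
by rewrite !raddfMz !mulrzz; ring.
Qed.

End Amalgam.

(** * The subgroup generated by the two images *)

Section SubgroupGroup.
Variables (G : groupType) (N : set G).
Hypothesis sN : subgroup N.

Definition sub_group : Type := let _ := sN in {x : G | `[< N x >]}.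

HB.instance Definition _ := Choice.on sub_group.

Let mk x (Nx : N x) : sub_group := exist _ x (asboolT Nx).
Let valN (u : sub_group) : N (val u) := asboolW (valP u).

Let one := mk (subgroup1 sN).
Let inv u := mk (subgroupV sN (valN u)).
Let mul u v := mk (subgroupM sN (valN u) (valN v)).

Let mulA : associative mul. Proof. by move=> u v w; apply/val_inj; rewrite /= mulgA. Qed.
Let mul1 : left_id one mul. Proof. by move=> u; apply/val_inj; rewrite /= mul1g. Qed.
Let mulr1 : right_id one mul. Proof. by move=> u; apply/val_inj; rewrite /= mulg1. Qed.
Let mulV : left_inverse one inv mul. Proof. by move=> u; apply/val_inj; rewrite /= mulVg. Qed.
Let mulrV : right_inverse one inv mul.
Proof. by move=> u; apply/val_inj; rewrite /= mulgV. Qed.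

HB.instance Definition _ := isGroup.Build sub_group mulA mul1 mulr1 mulV mulrV.

Let incl (u : sub_group) : G := val u.

Lemma subgroup_groupType :
  exists (E : groupType) (u : group_hom E G), injective u /\ range u = N.
Proof.
have incl_mor : incl 1 = 1 /\ {morph incl : x y / x * y} by split.
pose uA := isUMagmaMorphism.Build sub_group G incl incl_mor.
exists sub_group, (HB.pack incl uA : group_hom sub_group G); split; first exact: val_inj.
by apply/seteqP; split=> [_ [x _ <-]|x Nx]; [apply: valN|exists (mk Nx)].
Qed.

End SubgroupGroup.

Lemma corestriction (K E G : groupType) (u : group_hom E G) (h : group_hom K G) :
  injective u -> range h `<=` range u -> exists h' : group_hom K E, u \o h' =1 h.
Proof.
move=> u_inj hu; have /choice[f fE] x : exists y, u y = h x.
  by have [|y _ yE] := hu (h x); [exists x|exists y].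
have f_mor : f 1 = 1 /\ {morph f : x y / x * y}.
  by split=> [|x y]; apply: u_inj; rewrite ?gmulf1 ?gmulfM !fE ?gmulf1 ?gmulfM.
pose fA := isUMagmaMorphism.Build K E f f_mor.
by exists (HB.pack f fA : group_hom K E).
Qed.

Lemma generated_finitely_generated (E G : groupType) (u : group_hom E G) (S : set G) :
  injective u -> finite_set S -> range u = generated S -> finitely_generated E.
Proof.
move=> u_inj fS uS; exists (u @^-1` S); split.
  by apply: finite_preimage fS => x y _ _; apply: u_inj.
apply/seteqP; split=> // x _.
have : generated S `<=` u @` generated (u @^-1` S).
  apply: generated_min => [|y Sy]; first exact/image_subgroup/generated_subgroup.
  have : range u y by rewrite uS; apply: sub_generated.
  by move=> [z _ zy]; exists z => //; apply: sub_generated; rewrite /= zy.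
by rewrite -uS => /(_ (u x)) [|y gy /u_inj <-//]; exists x.
Qed.

Lemma generated_image (K G : groupType) (h : group_hom K G) (S : set K) (H : set G) :
  generated S = [set: K] -> subgroup H -> h @` S `<=` H -> range h `<=` H.
Proof.
move=> gS sH hSH _ [x _ <-]; have : generated S `<=` h @^-1` H.
  apply: generated_min; first exact: preimage_subgroup.
  by move=> y Sy; apply: hSH; exists y.
by rewrite gS; apply.
Qed.

Lemma wreath_subgroup_virtually_abelian (I : finType) (B : zmodType) (E : groupType)
    (u : group_hom E (wreath I B)) : injective u -> virtually_abelian E.
Proof.
move=> u_inj; exists (u @^-1` @wreath_base I B).
have sb := preimage_subgroup u (@wreath_base_subgroup I B); split=> //.
  by apply: cosets_finite_index => //; apply/finite_cosets_preimage/wreath_base_cosets.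
move=> x y; rewrite !inE => bx by_; apply: u_inj; rewrite !gmulfM.
by apply: wreath_base_abelian; rewrite inE.
Qed.

Theorem theorem1p1 (G0 G1 G2 G : groupType)
    (j1 : group_hom G0 G1) (j2 : group_hom G0 G2)
    (i1 : group_hom G1 G) (i2 : group_hom G2 G)
    (hG : amalgamated_free_product j1 j2 i1 i2)
    (hfg1 : finitely_generated G1) (hva1 : virtually_abelian G1)
    (hfg2 : finitely_generated G2) (hva2 : virtually_abelian G2)
    (hvc0 : virtually_cyclic G0) :
  exists (E : groupType) (nu : group_hom G E),
    [/\ finitely_generated E, virtually_abelian E,
        injective (nu \o i1) & injective (nu \o i2)].
Proof.
have [j1_inj j2_inj _ univ] := hG.
have [J [B [f1 [f2 [f1_inj f2_inj f12]]]]] :=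
  amalgam_embedding j1_inj j2_inj hfg1 hva1 hfg2 hva2 hvc0.
have [[S1 [fS1 gS1]] [S2 [fS2 gS2]]] := (hfg1, hfg2).
(* The whole wreath product need not be finitely generated, because [B] need not be. *)
pose S := f1 @` S1 `|` f2 @` S2.
have sgS := @generated_subgroup _ S.
have [E [u [u_inj uS]]] := subgroup_groupType sgS.
have [|h1 h1E] := @corestriction _ _ _ u f1 u_inj.
  by rewrite uS; apply: generated_image gS1 sgS _ => x S1x; apply: sub_generated; left.
have [|h2 h2E] := @corestriction _ _ _ u f2 u_inj.
  by rewrite uS; apply: generated_image gS2 sgS _ => x S2x; apply: sub_generated; right.
have h12 : h1 \o j1 =1 h2 \o j2.
  move=> y; apply: u_inj; have := f12 y.
  by rewrite /= -h1E -h2E.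
have [nu [nu1 nu2] _] := univ E h1 h2 h12.
exists E, nu; split.
- apply: generated_finitely_generated u_inj _ uS.
  by rewrite finite_setU; split; apply: finite_image.
- exact: wreath_subgroup_virtually_abelian u_inj.
- move=> x y; rewrite !nu1 => /(congr1 u).
  by rewrite -/((u \o h1) x) -/((u \o h1) y) !h1E => /f1_inj.
- move=> x y; rewrite !nu2 => /(congr1 u).
  by rewrite -/((u \o h2) x) -/((u \o h2) y) !h2E => /f2_inj.
Qed.
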